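(* Let $q$ be a prime power, $r$ a positive integer, $n=\frac{q^r-1}{q-1}$ and $k=\frac{q^r-1}{q-1}-r$ (the length and dimension of an $[n,k,3]_q$ Hamming code with redundancy $r=n-k$). If $k\ge 3$, then $$ r=\big\lceil k-\log_q(A_q(k,3))\big\rceil .$$
   Context: $A_q(k,d)$ is the maximum number of codewords in any $q$-ary code of length $k$ in which distinct codewords are at Hamming distance at least $d$. *)

(* Defs.v *)
From mathcomp Require Import all_boot all_order all_algebra.
From mathcomp Require Import reals exp.
Set Implicit Arguments.
Unset Strict Implicit.
Unset Printing Implicit Defensive.
Import Order.TTheory GRing.Theory Num.Theory.

Definition prime_power (q : nat) : Prop :=
  exists p m : nat, [/\ prime p, 0 < m & q = p ^ m].

Definition hamming_dist (T : eqType) (k : nat) (x y : k.-tuple T) : nat :=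
  #|[set i : 'I_k | tnth x i != tnth y i]|.

Definition min_dist_geq (T : finType) (k d : nat) (C : {set k.-tuple T}) : bool :=
  [forall x in C, forall y in C, (x != y) ==> (d <= hamming_dist x y)].

(* A_q(k,d). Only the size of the alphabet matters, so it is taken to be 'I_q;
   the default value 0 of the maximum plays no role, since the empty code
   qualifies. *)
Definition max_code_size (q k d : nat) : nat :=
  \max_(C : {set k.-tuple 'I_q} | min_dist_geq d C) #|C|.

Definition logb (R : realType) (b x : R) : R := (ln x / ln b)%R.

(* Main.v *)
Require Import Defs.
From mathcomp Require Import all_boot all_order all_algebra.
From mathcomp Require Import finfield.
From mathcomp Require Import reals exp.
From mathcomp Require Import zify lra.
Import Order.TTheory GRing.Theory Num.Theory.

Set Implicit Arguments.
Unset Strict Implicit.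
Unset Printing Implicit Defensive.

(** After clearing logarithms, the two inequalities behind the ceiling are
    [q ^ k <= q ^ r * A] and [A * q ^ (r - 1) < q ^ k], with [A = A_q(k,3)].
    The second is the Hamming bound, as [q ^ (r - 1) < 1 + k * (q - 1)] amounts to
    [r < q ^ (r - 1)], which [3 <= k] ensures.  For the first, choose [k] columns among
    the (at least [n]) pairwise independent vectors of [F_q ^ r]; every fibre of
    the syndrome map [F_q ^ k -> F_q ^ r] is a code of minimum distance 3, and
    one of the [q ^ r] fibres has at least the average size. *)

(** * Hamming distance and change of alphabet *)

Lemma hamming_distC (T : eqType) (k : nat) (x y : k.-tuple T) :
  hamming_dist x y = hamming_dist y x.
Proof. by apply: eq_card => i; rewrite !inE eq_sym. Qed.

Lemma hamming_dist_triangle (T : eqType) (k : nat) (x y z : k.-tuple T) :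
  hamming_dist x z <= hamming_dist x y + hamming_dist y z.
Proof.
rewrite (leq_trans _ (leq_card_setU _ _)) //; apply/subset_leq_card/subsetP => i.
by rewrite !inE; case: (tnth x i =P tnth y i) => [->|].
Qed.

Lemma hamming_dist_map (T U : eqType) (f : T -> U) (k : nat)
    (x y : k.-tuple T) :
  injective f ->
  hamming_dist (map_tuple f x) (map_tuple f y) = hamming_dist x y.
Proof. by move=> fI; apply: eq_card => i; rewrite !inE !tnth_map inj_eq. Qed.

Lemma min_dist_geqP (T : finType) (k d : nat) (C : {set k.-tuple T}) :
  reflect {in C &, forall x y, x != y -> d <= hamming_dist x y}
          (min_dist_geq d C).
Proof.
apply: (iffP forall_inP) => [H x y Cx Cy|H x Cx].
  by move/forall_inP: (H x Cx) => /(_ y Cy) /implyP.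
by apply/forall_inP => y Cy; apply/implyP; apply: H.
Qed.

(** Relabelling letters by [enum_rank] preserves size and distances, so codes over a field can be
    compared with codes over ['I_q]. *)
Lemma leq_max_code_size (T : finType) (k d : nat) (C : {set k.-tuple T}) :
  min_dist_geq d C -> #|C| <= max_code_size #|T| k d.
Proof.
move=> /min_dist_geqP dC.
pose f (x : k.-tuple T) := map_tuple enum_rank x.
have fI : injective f.
  by move=> x y /(congr1 val) /= /(inj_map enum_rank_inj); apply: val_inj.
rewrite -(card_imset _ fI) /max_code_size.
apply: (leq_bigmax_cond (F := fun C : {set k.-tuple 'I_#|T|} => #|C|)).
apply/min_dist_geqP => _ _ /imsetP[x Cx ->] /imsetP[y Cy ->] xy.
rewrite hamming_dist_map; last exact: enum_rank_inj.
by apply: dC => //; apply: contraNneq xy => ->.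
Qed.

(** * The sphere-packing bound *)

(** Parametrizes the ball of radius 1 around [x]: [None] is the centre, and [lift] skips the current
    letter, so each [Some (i, a)] really changes position [i]. *)
Definition change_letter {q k : nat} (x : k.-tuple 'I_q.+1)
    (o : option ('I_k * 'I_q)) : k.-tuple 'I_q.+1 :=
  if o is Some (i, a)
  then [tuple if j == i then lift (tnth x j) a else tnth x j | j < k]
  else x.

Lemma hamming_dist_change_letter (q k : nat) (x : k.-tuple 'I_q.+1) o :
  hamming_dist x (change_letter x o) <= 1.
Proof.
case: o => [[i a]|] /=.
  rewrite -(cards1 i); apply/subset_leq_card/subsetP => j.
  by rewrite !inE tnth_mktuple; case: (j =P i) => // _; rewrite eqxx.
by rewrite [hamming_dist _ _]eq_card0 // => j; rewrite !inE eqxx.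
Qed.

Lemma change_letter_inj (q k : nat) (x : k.-tuple 'I_q.+1) :
  injective (change_letter x).
Proof.
have neq i a : change_letter x (Some (i, a)) != x.
  apply/eqP => /(congr1 (fun y => tnth y i)); rewrite tnth_mktuple eqxx.
  by move/esym/eqP; apply/negP; apply: neq_lift.
case=> [[i a]|] [[j b]|] // E; last 2 first.
- by have := neq i a; rewrite E eqxx.
- by have := neq j b; rewrite -E eqxx.
move/(congr1 (fun y => tnth y i)): E; rewrite !tnth_mktuple eqxx.
case: (i =P j) => [<- /lift_inj -> //|_ /esym/eqP].
by rewrite (negPf (neq_lift _ _)).
Qed.

(** Balls of radius 1 around codewords at distance at least 3 are disjoint, and each has [1 + k * q]
    words. *)
Lemma hamming_bound (q k : nat) :
  max_code_size q.+1 k 3 * (k * q).+1 <= q.+1 ^ k.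
Proof.
suff bound (C : {set k.-tuple 'I_q.+1}) : min_dist_geq 3 C ->
    #|C| * (k * q).+1 <= q.+1 ^ k.
  (* The empty code shows that the maximum ranges over a nonempty family, hence is attained. *)
  have C0 : min_dist_geq 3 (set0 : {set k.-tuple 'I_q.+1}).
    by apply/min_dist_geqP => x y; rewrite inE.
  rewrite /max_code_size.
  have [|C dC ->] := @eq_bigmax_cond _
    [pred C : {set k.-tuple 'I_q.+1} | min_dist_geq 3 C] (fun C => #|C|).
    by apply/card_gt0P; exists set0.
  exact: bound.
move=> /min_dist_geqP dC.
pose g (u : k.-tuple 'I_q.+1 * option ('I_k * 'I_q)) := change_letter u.1 u.2.
have gI : {in setX C setT &, injective g}.
  move=> [x o] [y o']; rewrite !in_setX /= => /andP[Cx _] /andP[Cy _].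
  rewrite /g /= => E.
  have xy : x = y.
    apply/eqP/contraT => /(dC _ _ Cx Cy); rewrite leqNgt.
    rewrite ltnS (leq_trans (hamming_dist_triangle x (change_letter x o) y)) //.
    rewrite -[2]/(1 + 1) leq_add ?hamming_dist_change_letter //.
    by rewrite E hamming_distC hamming_dist_change_letter.
  by rewrite xy in E *; rewrite (change_letter_inj E).
have := max_card (mem (g @: setX C setT)).
rewrite card_in_imset // cardsX cardsT card_option card_prod !card_ord.
by rewrite card_tuple card_ord.
Qed.

(** * Large sets of pairwise independent vectors *)

Definition pairwise_independent {F : finFieldType} {r : nat}
    (S : {set 'rV[F]_r}) : bool :=
  (0%R \notin S) && [forall u in S, forall v in S,
    forall a : F, (u == a *: v)%R ==> (u == v)].

Lemma pairwise_independentP (F : finFieldType) (r : nat) (S : {set 'rV[F]_r}) :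
  reflect (0%R \notin S /\
           {in S &, forall u v, forall a : F, u = (a *: v)%R -> u = v})
          (pairwise_independent S).
Proof.
apply: (iffP andP) => -[S0 H]; split=> //.
  move=> u v Su Sv a E; apply/eqP.
  move/forall_inP: H => /(_ u Su) /forall_inP /(_ v Sv) /forallP /(_ a).
  by move/implyP; apply; apply/eqP.
apply/forall_inP => u Su; apply/forall_inP => v Sv; apply/forallP => a.
by apply/implyP => /eqP E; apply/eqP; apply: H E.
Qed.

(** Otherwise [w |: S] would still be pairwise independent, against maximality. *)
Lemma maxset_pairwise_independent (F : finFieldType) (r : nat)
    (S : {set 'rV[F]_r}) (w : 'rV[F]_r) :
  maxset pairwise_independent S -> w != 0%R ->
  exists2 u, u \in S & exists2 a : F, a != 0%R & w = (a *: u)%R.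
Proof.
move=> /maxsetP[/pairwise_independentP[S0 Sind] Smax] w0.
have [/exists_inP[u Su /existsP[a /andP[a0 /eqP E]]]|no] :=
    boolP [exists u in S, exists a : F, (a != 0%R) && (w == a *: u)%R].
  by exists u => //; exists a.
have noE u (a : F) : u \in S -> a != 0%R -> w <> (a *: u)%R.
  move=> Su a0 E; case/negP: no; apply/exists_inP; exists u => //.
  by apply/existsP; exists a; rewrite a0 E eqxx.
have nz (x y : 'rV[F]_r) a : x != 0%R -> x = (a *: y)%R -> a != 0%R.
  by move=> x0 E; apply: contraNneq x0 => a0; rewrite E a0 scale0r.
suff /Smax E : pairwise_independent (w |: S).
  have Sw : w \in S by rewrite -E ?setU11 ?subsetU1.
  by case: (noE w 1%R Sw (oner_neq0 F)); rewrite scale1r.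
apply/pairwise_independentP; split.
  by rewrite in_setU1 negb_or eq_sym w0.
move=> u v; rewrite !in_setU1.
case/predU1P=> [->|Su] /predU1P[->|Sv] a E //.
- by case: (noE v a Sv (nz _ _ _ w0 E)).
(* Here [u = a *: w]; inverting [a] turns [w] into a multiple of [u]. *)
- have u0 : u != 0%R by apply: contraNneq S0 => <-.
  have a0 := nz _ _ _ u0 E.
  case: (noE u a^-1%R Su); first by rewrite invr_eq0.
  by rewrite E scalerA mulVf // scale1r.
- exact: Sind E.
Qed.

(** For a maximal [S], scaling maps pairs of a member of [S] and a nonzero scalar onto all nonzero
    vectors. *)
Lemma exists_pairwise_independent (F : finFieldType) (r : nat) :
  exists2 S : {set 'rV[F]_r}, pairwise_independent S &
    #|F| ^ r - 1 <= #|S| * (#|F| - 1).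
Proof.
have ind0 : pairwise_independent (set0 : {set 'rV[F]_r}).
  by apply/pairwise_independentP; split=> [|u v]; rewrite inE.
have [S Smax _] := maxset_exists ind0.
exists S; first by case/maxsetP: Smax.
have -> : #|F| ^ r - 1 = #|[set~ 0%R : 'rV[F]_r]|.
  by rewrite cardsC1 card_mx mul1n subn1.
have -> : #|S| * (#|F| - 1) = #|setX S [set~ 0%R : F]|.
  by rewrite cardsX cardsC1 subn1.
pose g (u : 'rV[F]_r * F) := (u.2 *: u.1)%R.
apply: leq_trans (leq_imset_card g _).
apply/subset_leq_card/subsetP => w; rewrite !inE => w0.
have [u Su [a a0 ->]] := maxset_pairwise_independent Smax w0.
by apply/imsetP; exists (u, a); rewrite // !inE /= Su.
Qed.

(** * Syndrome fibres as codes *)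

(** The vectors [h i] are the columns of a parity-check matrix. *)
Definition syndrome {F : finFieldType} {r k : nat} (h : 'I_k -> 'rV[F]_r)
    (x : k.-tuple F) : 'rV[F]_r := (\sum_i tnth x i *: h i)%R.

(** Two words of a fibre at distance 1 or 2 would give a linear relation with one or two terms among
    the [h i]. *)
Lemma syndrome_fiber_min_dist (F : finFieldType) (r k : nat)
    (S : {set 'rV[F]_r}) (h : 'I_k -> 'rV[F]_r) (s : 'rV[F]_r) :
  pairwise_independent S -> injective h -> (forall i, h i \in S) ->
  min_dist_geq 3 [set x | syndrome h x == s].
Proof.
move=> /pairwise_independentP[S0 Sind] hI hS.
apply/min_dist_geqP => x y; rewrite !inE => /eqP <- /eqP /esym E xy.
pose e i := (tnth x i - tnth y i)%R.
have {E} E : (\sum_i e i *: h i = 0)%R.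
  rewrite (eq_bigr (fun i => tnth x i *: h i - tnth y i *: h i)%R).
    by rewrite sumrB -/(syndrome h x) E subrr.
  by move=> i _; rewrite scalerBl.
have eP i : (e i == 0%R) = (tnth x i == tnth y i) by rewrite subr_eq0.
have [i xyi] : exists i, tnth x i != tnth y i.
  apply/existsP; apply: contraNT xy; rewrite negb_exists => /forallP H.
  by apply/eqP/eq_from_tnth => i; apply/eqP; have := H i; rewrite negbK.
rewrite ltnNge; apply/negP => d2.
pose D := [set j | tnth x j != tnth y j].
have cD : #|D :\ i| <= 1.
  by move: d2; rewrite /hamming_dist -/D (cardsD1 i) inE xyi.
have ei : e i != 0%R by rewrite eP.
have solve j (b : F) : (e i *: h i + b *: h j = 0)%R -> h i = h j.
  move=> H; apply: (Sind _ _ (hS i) (hS j) (- (e i)^-1 * b)%R).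
  rewrite -scalerA scaleNr; move/eqP: H; rewrite addrC addr_eq0 => /eqP ->.
  by rewrite scalerN opprK scalerA mulVf // scale1r.
have out j : j \notin D -> e j = 0%R.
  by rewrite inE negbK -eP => /eqP.
(* If [i] is the only difference, then [h i = 0]; with a second one [j], [h i = h j] contradicts
   injectivity. *)
have [D1|[j Dj]] := set_0Vmem (D :\ i).
  move: E; rewrite (bigD1 i) //= big1 ?addr0 => [/eqP|j ji].
    rewrite scaler_eq0 (negPf ei) /= => /eqP hi0.
    by move/negP: S0; apply; rewrite -hi0.
  by move/setP: D1 => /(_ j); rewrite in_setD1 ji in_set0 => /negbT/out ->; rewrite scale0r.
have ij : j != i by move: Dj; rewrite !inE => /andP[].
move: E; rewrite (bigD1 i) //= (bigD1 j) //= big1 ?addr0 => [/solve /hI|l].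
  by move/esym/eqP; apply/negP.
case/andP=> li lj; rewrite out ?scale0r //; apply: contra lj => Dl.
by move/card_le1_eqP: cD => /(_ l j); rewrite Dj in_setD1 li Dl => ->.
Qed.

Lemma leq_card_syndrome_fibers (F : finFieldType) (r k : nat) :
  k * (#|F| - 1) <= #|F| ^ r - 1 ->
  #|F| ^ k <= #|F| ^ r * max_code_size #|F| k 3.
Proof.
have F1 : 0 < #|F| - 1 by rewrite subn_gt0 finNzRing_gt1.
have [S Sind Sbig] := exists_pairwise_independent F r.
move=> /leq_trans /(_ Sbig); rewrite leq_pmul2r // => kS.
pose h (i : 'I_k) : 'rV[F]_r := enum_val (widen_ord kS i).
have hI : injective h.
  by move=> i j /enum_val_inj /(congr1 val) /= /val_inj.
have hS i : h i \in S by apply: enum_valP.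
(* Count all words fibre by fibre over the [#|F| ^ r] syndromes. *)
rewrite -(card_tuple k F) -sum1_card.
rewrite (partition_big (syndrome h) predT) //=.
have -> : #|F| ^ r = #|'rV[F]_r| by rewrite card_mx mul1n.
rewrite -sum_nat_const; apply: leq_sum => s _.
rewrite sum1dep_card; apply: leq_max_code_size.
exact: syndrome_fiber_min_dist hI hS.
Qed.

(** * From inequalities to the ceiling *)

(** Taking logarithms, the hypotheses become [r - 1 < k - log_q A <= r]. *)
Lemma ceil_sub_logb (R : realType) (q r k A : nat) :
  1 < q -> 0 < r -> q ^ k <= q ^ r * A -> A * q ^ r.-1 < q ^ k ->
  (Num.ceil (k%:R - logb q%:R A%:R : R) = r%:Z)%R.
Proof.
move=> q1 r0 lo hi; have q0 : 0 < q := ltnW q1.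
have A0 : 0 < A.
  by case: A lo {hi} => //; rewrite muln0 leqn0 expn_eq0 eqn0Ngt q0.
have Lq : (0 < ln q%:R :> R)%R by rewrite ln_gt0 // ltr1n.
have lnX m : (ln (q ^ m)%:R = m%:R * ln q%:R :> R)%R.
  by rewrite natrX lnXn ?ltr0n // mulr_natl.
have lnMX m : (ln (A * q ^ m)%:R = ln A%:R + m%:R * ln q%:R :> R)%R.
  by rewrite natrM lnM ?posrE ?ltr0n ?expn_gt0 ?q0 // lnX.
have {}lo : (k%:R * ln q%:R <= ln A%:R + r%:R * ln q%:R :> R)%R.
  rewrite -lnMX -lnX.
  by rewrite ler_ln ?posrE ?ltr0n ?muln_gt0 ?expn_gt0 ?q0 ?A0 // ler_nat mulnC.
have {}hi : (ln A%:R + (r%:R - 1) * ln q%:R < k%:R * ln q%:R :> R)%R.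
  have -> : (r%:R - 1 = r.-1%:R :> R)%R by rewrite -subn1 natrB.
  rewrite -lnMX -lnX.
  by rewrite ltr_ln ?posrE ?ltr0n ?muln_gt0 ?expn_gt0 ?q0 ?A0 // ltr_nat.
have E : (ln A%:R = logb q%:R A%:R * ln q%:R :> R)%R.
  by rewrite /logb mulfVK // gt_eqF.
apply: ceil_def; rewrite intrD rmorphN /= -!pmulrn.
move: lo hi; rewrite E -!mulrDl ler_pM2r // ltr_pM2r //.
by move=> ? ?; apply/andP; split; lra.
Qed.

(** Substituting for [n * (q - 1)] and cancelling [q - 1] leaves [r < q ^ (r - 1)]. *)
Lemma hamming_length_ineq (q r n : nat) :
  1 < q -> 0 < r -> n * (q - 1) = q ^ r - 1 -> 3 <= n - r ->
  q ^ r.-1 < ((n - r) * (q - 1)).+1.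
Proof.
case: r => // s q1 _ nE k3 /=.
have sN : s < q ^ s := ltn_expl s q1.
move: nE; rewrite expnS => nE.
suff rN : s.+1 < q ^ s by nia.
(* Only [s.+1 = q ^ s] remains. With [s <= 1] it would give [n - r <= 1]; for larger [s] the power
   is too big. *)
rewrite ltn_neqAle sN andbT; apply/eqP => rN.
have s1 : 1 < s by nia.
case: s s1 {nE k3 sN} rN => // t t0.
rewrite expnS; have := ltn_expl t q1; nia.
Qed.

Theorem mainTheorem4 (R : realType) (q r n k : nat) (hq : prime_power q)
    (hr : 0 < r) (hn : n = (q ^ r - 1) %/ (q - 1)) (hk : k = n - r)
    (hk3 : 3 <= k) :
  (r%:Z = Num.ceil (k%:R - logb q%:R (max_code_size q k 3)%:R : R))%R.
Proof.
have [p [m [p_pr m0 qE]]] := hq.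
have [F _ cardF] := pPrimePowerField p_pr m0; rewrite -qE in cardF.
have q1 : 1 < q by rewrite -cardF finNzRing_gt1.
have nE : n * (q - 1) = q ^ r - 1.
  by rewrite hn divnK // !subn1 predn_exp dvdn_mulr.
have lo : q ^ k <= q ^ r * max_code_size q k 3.
  rewrite -cardF; apply: leq_card_syndrome_fibers.
  by rewrite cardF -nE leq_mul2r hk leq_subr orbT.
symmetry; apply: ceil_sub_logb => //.
(* Positivity keeps the inequality [gap] strict after multiplication by the code size. *)
have A0 : 0 < max_code_size q k 3.
  by case: (max_code_size _ _ _) lo => //; rewrite muln0 leqn0 expn_eq0; case: (q) q1.
have gap : q ^ r.-1 < (k * (q - 1)).+1.
  by rewrite hk; apply: hamming_length_ineq; rewrite -?hk.
have := hamming_bound (q - 1) k.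
rewrite subn1 prednK ?(ltnW q1) // -subn1.
by apply: leq_trans; rewrite ltn_pmul2l.
Qed.
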